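(* Let $F$ and $G$ be abelian groups, let $\varnothing\neq\Psi\subseteq\operatorname{Hom}(F,G)$, and put $N_{\Psi} = \bigcap_{\psi\in\Psi}\ker(\psi).$ If $F/N_{\Psi}$ is finite, then ${\rm D}_{\Psi}(G)$ is finite and $F^n$ is uniformly $\Psi$-kernel-cover compact for every integer $n\geq {\rm D}_{\Psi}(G)$.
   Context: Groups may be infinite. $\operatorname{Hom}(F,G)$ is the group of all homomorphisms $F\to G$, and $\mathbf 0$ is the zero homomorphism. For $\boldsymbol{\eta}=(\psi_1,\ldots,\psi_n)\in\operatorname{Hom}(F,G)^n$, the induced universal homomorphism $\operatorname{ind}[\boldsymbol{\eta}]:F^n\to G$ is given by $\operatorname{ind}[\boldsymbol{\eta}](x_1,\ldots,x_n)=\sum_{i=1}^n\psi_i(x_i)$. A sequence over $F$ is a finite unordered sequence (multiset) of elements of $F$, repetition allowed; its length is the number of terms counted with multiplicity, and subsequences are sub-multisets. For a nonempty subset $\Psi\subseteq\operatorname{Hom}(F,G)$, the $\Psi$-weighted Davenport constant ${\rm D}_\Psi(G)$ is the least positive integer $\ell$ such that every sequence $T$ over $F$ of length $\ell$ has a nonempty subsequence $a_1\cdot\ldots\cdot a_k$ ($k>0$) with $\sum_{i=1}^k\psi_i(a_i)=0_G$ for some (not necessarily distinct) $\psi_1,\ldots,\psi_k\in\Psi$; if no such $\ell$ exists, ${\rm D}_\Psi(G)=\infty$. For $n\ge1$ put $$\mathcal K_n(\Psi)=\left\{\ker(\operatorname{ind}[\boldsymbol{\eta}]):\boldsymbol{\eta}\in(\Psi\cup\{\mathbf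 0\})^n\setminus\{(\mathbf 0,\ldots,\mathbf 0)\}\right\}.$$ $F^n$ is called uniformly $\Psi$-kernel-cover compact if for every subset $X\subseteq F^n$, every cover of $X$ by members of $\mathcal K_n(\Psi)$ (i.e. every subfamily of $\mathcal K_n(\Psi)$ whose union contains $X$) has a finite subcover (a finite subfamily whose union contains $X$). *)

(* Defs.v *)
From HB Require Import structures.
From mathcomp Require Import all_boot all_order all_algebra.
From mathcomp Require Import finmap multiset.
From mathcomp Require Import boolp classical_sets cardinality.
Set Implicit Arguments.
Unset Strict Implicit.
Unset Printing Implicit Defensive.
Import GRing.Theory.
Local Open Scope classical_set_scope.
Local Open Scope ring_scope.

Definition kernel (U V : zmodType) (f : {additive U -> V}) : set U :=
  [set x | f x = 0].

(* The quotient U / N, as a plain set of cosets of N. *)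
Definition cosets (U : zmodType) (N : set U) : set (set U) :=
  [set [set x + z | z in N] | x in [set: U]].

(* Elements of F^n are finite functions, so that F^n is itself a zmodType. *)
Definition ind (F G : zmodType) (n : nat) (eta : 'I_n -> {additive F -> G})
    (x : {ffun 'I_n -> F}) : G :=
  \sum_(i < n) eta i (x i).

Fact ind_is_zmod_morphism (F G : zmodType) (n : nat)
  (eta : 'I_n -> {additive F -> G}) : zmod_morphism (ind eta).
Proof.
move=> x y; rewrite /ind -sumrB; apply: eq_bigr => i _.
by rewrite !ffunE raddfB.
Qed.

HB.instance Definition _ (F G : zmodType) (n : nat)
    (eta : 'I_n -> {additive F -> G}) :=
  GRing.isZmodMorphism.Build {ffun 'I_n -> F} G (ind eta)
    (ind_is_zmod_morphism eta).

Definition zero_hom (F G : zmodType) : {additive F -> G} := \0.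

Definition has_weighted_zero_sum (F G : zmodType) (Psi : set {additive F -> G})
    (T : {mset F}%mset) : Prop :=
  exists (k : nat) (a : k.-tuple F) (psi : 'I_k -> {additive F -> G}),
    [/\ (0 < k)%N, (seq_mset a `<=` T)%mset, forall i, Psi (psi i)
      & \sum_(i < k) psi i (tnth a i) = 0].

Definition davenport_bound (F G : zmodType) (Psi : set {additive F -> G}) :
    pred nat :=
  fun l => `[< (0 < l)%N /\
    forall T : {mset F}%mset, size T = l -> has_weighted_zero_sum Psi T >].

(* [None] stands for infinity. *)
Definition davenport (F G : zmodType) (Psi : set {additive F -> G}) :
    option nat :=
  if pselect (exists l, davenport_bound Psi l) is left h
  then Some (ex_minn h) else None.

Definition kernel_family (F G : zmodType) (Psi : set {additive F -> G})
    (n : nat) : set (set {ffun 'I_n -> F}) :=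
  [set kernel (ind eta) | eta in
    [set eta : 'I_n -> {additive F -> G} |
      (forall i, (Psi `|` [set zero_hom F G]) (eta i)) /\
      eta <> (fun=> zero_hom F G)]].

Arguments kernel_family {F G} Psi n _.

Definition uniformly_kernel_cover_compact (F G : zmodType)
    (Psi : set {additive F -> G}) (n : nat) : Prop :=
  forall (X : set {ffun 'I_n -> F}) (C : set (set {ffun 'I_n -> F})),
    C `<=` kernel_family Psi n -> X `<=` \bigcup_(K in C) K ->
    exists C' : set (set {ffun 'I_n -> F}),
      [/\ C' `<=` C, finite_set C' & X `<=` \bigcup_(K in C') K].

(* Main.v *)
Require Import Defs.
From mathcomp Require Import all_boot all_order all_algebra.
From mathcomp Require Import finmap multiset.
From mathcomp Require Import boolp classical_sets cardinality.
Import GRing.Theory.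
Local Open Scope classical_set_scope.
Local Open Scope ring_scope.

(** As [F / N] is finite with [m] elements, two of the [m + 1] partial sums of
a sequence of length at least [m] agree modulo [N], so a nonempty subsequence
sums into [N] and is killed by any constant choice of weight. Every kernel in
[kernel_family Psi n] is a union of cosets of [N ^ n], of which there are
finitely many; hence the family itself is finite, and every cover is already
finite. *)

(** The colour of [x] is the position of [x + N] in an enumeration of the cosets. As [N] contains
    [0], equal colours put [x] in [x + N = y + N]. *)
Lemma finite_cosets_coloring (F : zmodType) (N : set F) :
  N 0 -> finite_set (cosets N) ->
  exists (m : nat) (c : F -> 'I_m), forall x y, c x = c y -> N (x - y).
Proof.
move=> N0 /finite_seqP[s sE]; pose q (x : F) : set F := [set x + z | z in N].
have qs x : q x \in s.
  by have : cosets N (q x) by [exists x]; rewrite sE.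
have lts x : (index (q x) s < size s)%N by rewrite index_mem.
exists (size s), (fun x => Ordinal (lts x)) => x y /(congr1 val) /= eqi.
have eqq : q x = q y by rewrite -(nth_index set0 (qs x)) eqi nth_index.
have : q x x by exists 0; rewrite ?addr0.
by rewrite eqq => -[z Nz <-]; rewrite addrAC subrr add0r.
Qed.

Lemma seq_mset_take_drop_sub (K : choiceType) (T : {mset K}%mset) (i j : nat) :
  (seq_mset (take j (drop i T)) `<=` T)%mset.
Proof.
apply/msubsetP => x; rewrite mset_seqE -count_mem_mset.
rewrite -{2}(cat_take_drop i T) count_cat.
by rewrite -{2}(cat_take_drop j (drop i T)) count_cat addnCA leq_addr.
Qed.

Section Coloring.
Variables (F G : zmodType) (Psi : set {additive F -> G}).
Variables (m : nat) (c : F -> 'I_m).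
Hypothesis c_eq : forall psi : {additive F -> G}, Psi psi ->
  forall x y, c x = c y -> psi x = psi y.

Lemma coloring_weighted_zero_sum (T : {mset F}%mset) :
  Psi !=set0 -> (m <= size T)%N -> has_weighted_zero_sum Psi T.
Proof.
move=> [psi Ppsi] szT; pose S (i : nat) := \sum_(x <- take i T) x.
have /injectivePn[i [j ij cij]] : ~~ injectiveb (fun i : 'I_m.+1 => c (S i)).
  by apply/injectiveP => /leq_card; rewrite !card_ord ltnn.
wlog ltij : i j ij cij / (i < j)%N.
  move=> W; have [/W|/W|/val_inj eij] := ltngtP i j; first exact.
    by apply; rewrite // eq_sym.
  by rewrite eij eqxx in ij.
have sza : size (take (j - i) (drop i T)) == (j - i)%N.
  by rewrite size_takel // size_drop leq_sub2r // (leq_trans _ szT) // -ltnS.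
(* The subsequence is the block of terms between the prefixes of lengths [i] and [j]. *)
exists (j - i)%N, (Tuple sza), (fun=> psi).
split=> //; [by rewrite subn_gt0 | exact: seq_mset_take_drop_sub |].
rewrite -raddf_sum -(big_tuple _ _ (Tuple sza) xpredT id) /=.
(* Adding [psi (S i)] to the image of the block gives [psi (S j)], which equals [psi (S i)] because
   the colours agree. *)
apply: (addrI (psi (S i))); rewrite addr0 [RHS](c_eq _ Ppsi _ _ cij) -raddfD.
by rewrite -big_cat -takeD subnKC // ltnW.
Qed.

Lemma finite_kernel_family (n : nat) : finite_set (kernel_family Psi n).
Proof.
pose cc (x : {ffun 'I_n -> F}) := [ffun i => c (x i)].
pose U (A : {set {ffun 'I_n -> 'I_m}}) := [set x | cc x \in A].
(* Each kernel will be the preimage under [cc] of a set of colour vectors, and there are finitely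
   many such sets. *)
apply: (@sub_finite_set _ _ (U @` setT)); last exact/finite_image/finite_finset.
move=> _ [eta [Peta _] <-].
exists [set y | `[< exists2 x, ind eta x = 0 & cc x = y >]]%SET => //.
apply/seteqP; split=> x; rewrite /U /kernel /= inE; last first.
  by move=> kx; apply/asboolP; exists x.
(* A point [x] with the colours of a kernel element [y] has the same image as [y], coordinate by
   coordinate. *)
move=> /asboolP[y ky cyx]; rewrite -ky; apply: eq_bigr => i _.
have /ffunP/(_ i) := cyx; rewrite !ffunE => cyxi.
by case: (Peta i) => [P|->//]; apply: c_eq.
Qed.

End Coloring.

Theorem proposition4p8 (F G : zmodType) (Psi : set {additive F -> G})
    (Psi_neq0 : Psi !=set0)
    (finFN : finite_set (cosets (\bigcap_(psi in Psi) kernel psi))) :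
  exists D : nat, davenport Psi = Some D /\
    forall n : nat, (D <= n)%N -> uniformly_kernel_cover_compact Psi n.
Proof.
have [|m [c cN]] := finite_cosets_coloring _ _ _ finFN.
  by move=> psi _; exact: raddf0.
have c_eq psi : Psi psi -> forall x y, c x = c y -> psi x = psi y.
  move=> Ppsi x y /cN/(_ psi Ppsi); rewrite /kernel /= raddfB.
  exact: subr0_eq.
have bound : exists l, davenport_bound Psi l.
  (* The successor makes positivity immediate; the least bound is left to [ex_minn]. *)
  exists m.+1; apply/asboolP; split=> // T szT.
  by apply: (coloring_weighted_zero_sum _ _ _ _ _ c_eq); rewrite ?szT.
rewrite /davenport; case: pselect => // h; exists (ex_minn h); split=> // n _.
move=> X C CK XC; exists C; split=> //.
exact: sub_finite_set CK (finite_kernel_family _ _ _ _ _ c_eq n).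
Qed.
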